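(* Let $f\colon \mathbb{R}\to \mathbb{R}$ be a continuous function. Then the following statements are valid. (a) The set $l_f=\{x\in\mathbb{R}:\operatorname{lip} f(x)<\infty\}$ is a $G_{\delta\sigma}$ set. (b) The set $L_f=\{x\in\mathbb{R}:\operatorname{Lip} f(x)<\infty\}$ is an $F_\sigma$ set. (c) The set $\{x\in\mathbb{R}:\operatorname{lip} f(x)=0\}$ is a $G_\delta$ set.
   Context: An $F_\sigma$ set is a countable union of closed sets, a $G_\delta$ set is a countable intersection of open sets, and a $G_{\delta\sigma}$ set is a countable union of $G_\delta$ sets. For a continuous function $f\colon\mathbb{R}\to\mathbb{R}$ and $x\in\mathbb{R}$, $$\operatorname{lip} f(x)=\liminf_{r\to 0^+}\ \sup_{|x-y|\le r}\frac{|f(y)-f(x)|}{r},\qquad \operatorname{Lip} f(x)=\limsup_{r\to 0^+}\ \sup_{|x-y|\le r}\frac{|f(y)-f(x)|}{r},$$ with values in $[0,\infty]$. *)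

(* Defs.v *)
From mathcomp Require Import all_boot all_order all_algebra.
From mathcomp Require Import all_classical all_reals all_analysis.
From mathcomp Require Import borel_hierarchy.
Import Order.TTheory GRing.Theory Num.Theory.
Import numFieldNormedType.Exports.

Set Implicit Arguments.
Unset Strict Implicit.
Unset Printing Implicit Defensive.

Local Open Scope classical_set_scope.
Local Open Scope ring_scope.

Section local_lipschitz.
Context {R : realType}.
Implicit Types (f : R -> R) (x r : R).

Definition lip_quotient f x r : \bar R :=
  ereal_sup [set (`|f y - f x| / r)%:E | y in [set y | `|x - y| <= r]].

Definition lip f x : \bar R := limf_einf (lip_quotient f x) 0^'+.

Definition Lip f x : \bar R := limf_esup (lip_quotient f x) 0^'+.

End local_lipschitz.

Definition Gdelta_sigma {T : topologicalType} (S : set T) : Prop :=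
  exists2 F : (set T)^nat, (forall i, Gdelta (F i)) & S = \bigcup_i (F i).

(* Main.v *)
Require Import Defs.
From mathcomp Require Import all_boot all_order all_algebra.
From mathcomp Require Import all_classical all_reals all_analysis.
From mathcomp Require Import borel_hierarchy.
From mathcomp Require Import lra.
Import Order.TTheory GRing.Theory Num.Theory.
Import numFieldNormedType.Exports.

Local Open Scope classical_set_scope.
Local Open Scope ring_scope.

(** Write q(x, r) for the supremum of |f y - f x| / r over |x - y| <= r, and
    V(c, s) for the set of x such that q(x, r) < c at some scale 0 < r < s.

    For (a) and (c), the point is that V(c, s) is open, although q(., r) at a
    fixed scale r is upper semicontinuous only by a compactness argument. If
    q(x, r) < c, then at a point z close to x the scale is shrunk to
    r' = r - d with |x - z| < d: the r'-ball around z lies in the r-ball around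
    x, so the oscillation bound at x carries over to z up to the small error
    |f x - f z|, and the strict inequality leaves room both for this error and
    for the loss from r to r' ([open_lip_small]). Then lip f x < oo iff for
    some n the point x lies in V(n, 1/(m+1)) for all m, a countable union of
    countable intersections of open sets ([lip_ltyP]); and lip f x = 0 iff x lies in V(1/(n+1), 1/(n+1))
    for all n, since V(c, s) increases with c and s ([lip_eq0P]).

    For (b), q(x, r) <= K for all r < d says that f satisfies
    |f y - f x| <= K |x - y| for all y with |x - y| < d: the best scale for
    testing a given y is r = |x - y|. Each y imposes a closed condition on x,
    because the constraint |x - y| < d that triggers it is open; so these sets
    are closed ([closed_local_lipschitz]), and taking K = n, d = 1/(n+1) they
    exhaust the set where Lip f is finite ([Lip_ltyP]). *)

Lemma at_right0P {R : realType} (P : set R) :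
  0^'+ P <-> exists2 s, 0 < s & forall r, 0 < r < s -> P r.
Proof.
split=> [[s /= s0 sP]|[s s0 sP]]; exists s => //.
  move=> r /andP[r0 rs]; apply: sP => //=.
  by rewrite sub0r normrN gtr0_norm.
move=> r /= + r0; rewrite sub0r normrN gtr0_norm// => rs.
by apply: sP; rewrite r0.
Qed.

Lemma exists_natSinv_lt {R : realType} {s : R} :
  0 < s -> exists n, n.+1%:R^-1 < s.
Proof.
by move=> s0; have [n _ /(_ n (leqnn n))] := near_infty_natSinv_lt (PosNum s0);
  exists n.
Qed.

Lemma lty_exists_nat {R : realType} (a : \bar R) :
  (a < +oo)%E -> exists n : nat, (a < n%:R%:E)%E.
Proof.
case: a => [a _|//|_]; last by exists 0%N; rewrite ltNyr.
by exists (Num.truncn a).+1; rewrite lte_fin truncnS_gt.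
Qed.

(** The margin between c and d is there because a limit inferior equal to c
    may be approached from above only. Left to right this is used with c the
    limit inferior itself, right to left with c = 0 or c = n. *)
Lemma limf_einf_at_right0_leP {R : realType} (g : R -> \bar R) (c : \bar R) :
  (limf_einf g 0^'+ <= c)%E <->
  forall d, (c < d)%E -> forall s, 0 < s ->
    exists2 r, 0 < r < s & (g r < d)%E.
Proof.
rewrite limf_einfE; split=> [gc d cd s s0|gc].
  have : (ereal_inf (g @` [set r | (0 < r < s)%R]) < d)%E.
    apply: le_lt_trans cd; apply: le_trans gc.
    apply: ereal_sup_ubound; exists [set r | 0 < r < s] => //.
    by apply/at_right0P; exists s.
  by move=> /ereal_inf_lt[_ [r r0s <-] grd]; exists r.
rewrite leNgt; apply/negP => /ereal_sup_gt[_ [V /at_right0P[s s0 sV] <-] cV].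
have [r /sV Vr] := gc _ cV _ s0.
by rewrite ltNge => /negP; apply; apply: ereal_inf_lbound; exists r.
Qed.

(** A single integer can serve both as the bound and as the inverse scale,
    because enlarging it weakens the bound and shrinks the interval. *)
Lemma limf_esup_at_right0_ltyP {R : realType} (g : R -> \bar R) :
  (limf_esup g 0^'+ < +oo)%E <->
  exists n : nat, forall r, 0 < r < n.+1%:R^-1 -> (g r <= n%:R%:E)%E.
Proof.
rewrite limf_esupE; split=> [|[n gn]].
  move=> /ereal_inf_lt[_ [V /at_right0P[s s0 sV] <-]] /lty_exists_nat[n gn].
  have [m ms] := exists_natSinv_lt s0.
  exists (maxn n m) => r /andP[r0 rs].
  apply: (@le_trans _ _ n%:R%:E); last by rewrite lee_fin ler_nat leq_maxl.
  apply: le_trans (ltW gn); apply: ereal_sup_ubound; exists r => //.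
  apply: sV; rewrite r0 (lt_trans (lt_le_trans rs _) ms)//.
  by rewrite lef_pV2 ?posrE ?ltr0n// ler_nat ltnS leq_maxr.
apply: (@le_lt_trans _ _ n%:R%:E); last exact: ltry.
apply: ge_ereal_inf; exists (ereal_sup (g @` [set r | 0 < r < n.+1%:R^-1])).
  exists [set r | 0 < r < n.+1%:R^-1] => //.
  by apply/at_right0P; exists n.+1%:R^-1.
by apply: ge_ereal_sup => _ [r /gn grn <-].
Qed.

Section local_lipschitz_sets.
Context {R : realType}.
Implicit Types (f : R -> R) (x r c s : R).

Lemma lip_quotient_leP f x r c : 0 < r ->
  (lip_quotient f x r <= c%:E)%E <->
  forall y, `|x - y| <= r -> `|f y - f x| <= c * r.
Proof.
move=> r0; split=> [/ereal_supP fc y xyr|fc].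
  by rewrite -ler_pdivrMr// -lee_fin; apply: fc; exists y.
apply: ge_ereal_sup => _ [y /= /fc fyc <-].
by rewrite lee_fin ler_pdivrMr.
Qed.

Lemma lip_quotient_ge0 f x r : 0 < r -> (0 <= lip_quotient f x r)%E.
Proof.
move=> r0; apply: ereal_sup_ubound; exists x => /=.
  by rewrite subrr normr0 ltW.
by rewrite subrr normr0 mul0r.
Qed.

Lemma lip_ge0 f x : (0 <= lip f x)%E.
Proof.
rewrite /lip limf_einfE; apply: le_ereal_sup_tmp.
exists (ereal_inf (lip_quotient f x @` [set r | 0 < r < 1])).
  by exists [set r | 0 < r < 1] => //; apply/at_right0P; exists 1.
by apply: le_ereal_inf_tmp => _ [r /andP[r0 _] <-]; exact: lip_quotient_ge0.
Qed.

Definition lip_small f c s : set R :=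
  [set x | exists2 r, 0 < r < s & (lip_quotient f x r < c%:E)%E].

(** The scale is not kept fixed but shrunk by the distance to the new point,
    so that the new ball stays inside the old one. *)
Lemma open_lip_small f c s : continuous f -> open (lip_small f c s).
Proof.
move=> cf; rewrite openE => x [r /andP[r0 rs]].
case E : (lip_quotient f x r) (lip_quotient_ge0 f x r r0) => [a| |]// _.
rewrite lte_fin => ac.
have /(lip_quotient_leP _ _ _ _ r0) fxa : (lip_quotient f x r <= a%:E)%E.
  by rewrite E.
have a0 : 0 <= a by rewrite -lee_fin -E lip_quotient_ge0.
(* The slope a at x and scale r is relaxed to b < c at z and scale r - e / b.
   The gap is (b - a) r = 2 e: the radius loss costs b (e / b) = e, and e is
   left for |f x - f z|. *)
pose b := (a + c) / 2.
pose e := (b - a) * r / 2.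
have [ab bc] : a < b /\ b < c by rewrite /b; lra.
have b0 : 0 < b by lra.
have e0 : 0 < e by rewrite /e; nra.
have bde : b * (e / b) = e by rewrite mulrC divfK// gt_eqF.
have d0 : 0 < e / b by rewrite divr_gt0.
have dr : e / b < r by rewrite ltr_pdivrMr// /e; nra.
have xd : \forall z \near x, `|x - z| < e / b.
  by have := @cvg_id _ (nbhs x) => /cvgr_dist_lt; apply.
near=> z; exists (r - e / b); first by apply/andP; split; lra.
apply: (@le_lt_trans _ _ b%:E); last by rewrite lte_fin.
apply/lip_quotient_leP => [|y zy]; first lra.
rewrite mulrBr bde (le_trans (ler_distD (f x) _ _))//.
have fxz : `|f x - f z| <= e.
  by apply/ltW; near: z; have /cvgr_dist_lt := cf x; apply.
have : `|f y - f x| <= a * r.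
  apply: fxa; have := ler_distD z x y.
  have : `|x - z| < e / b by near: z.
  lra.
by move: fxz; rewrite /e; nra.
Unshelve. all: by end_near. Qed.

(** For fixed y the condition on x is the disjunction of d <= |x - y| and
    |f y - f x| <= K |x - y|, hence closed. *)
Lemma closed_local_lipschitz f (K d : R) : continuous f ->
  closed [set x | forall y, `|x - y| < d -> `|f y - f x| <= K * `|x - y|].
Proof.
move=> cf.
pose far y := (fun x => - `|x - y|) @^-1` [set t | t <= - d].
pose flat y := (fun x => `|f y - f x| - K * `|x - y|) @^-1` [set t | t <= 0].
have cdist y : continuous (fun x => `|x - y|).
  by move=> x; apply: cvg_norm; apply: cvgB; [exact: cvg_id|exact: cvg_cst].
have -> : [set x | forall y, `|x - y| < d -> `|f y - f x| <= K * `|x - y|] =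
    \bigcap_y (far y `|` flat y).
  apply/seteqP; split=> [x xP y _|x xP y xy].
    rewrite /far /flat /= lerN2 subr_le0.
    by case: (leP d `|x - y|) => [|/xP]; [left|right].
  have := xP y I; rewrite /far /flat /= lerN2 subr_le0 => -[|//].
  by rewrite leNgt xy.
apply: closed_bigI => y _; apply: closedU.
  apply: (continuous_closedP _).1; last exact: closed_le.
  by move=> x; apply: cvgN; exact: cdist.
apply: (continuous_closedP _).1; last exact: closed_le.
move=> x; apply: cvgB.
  by apply: cvg_norm; apply: cvgB; [exact: cvg_cst|exact: cf].
by apply: cvgM; [exact: cvg_cst|exact: cdist].
Qed.

(** The quotients at all small scales are bounded by n iff the slopes of the
    chords from x are: a chord to y is tested at the scale |x - y|, and
    conversely a chord of slope at most n with |x - y| <= r rises by at most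
    n r. *)
Lemma Lip_ltyP f x : (Lip f x < +oo)%E <->
  exists n : nat, forall y, `|x - y| < n.+1%:R^-1 ->
    `|f y - f x| <= n%:R * `|x - y|.
Proof.
rewrite /Lip limf_esup_at_right0_ltyP; split=> -[n fn]; exists n.
  move=> y xyn; have [->|xy] := eqVneq x y.
    by rewrite !subrr normr0 mulr0.
  have xy0 : 0 < `|x - y| by rewrite normr_gt0 subr_eq0.
  by apply: (lip_quotient_leP f x _ _ xy0).1; rewrite ?fn ?xy0.
move=> r /andP[r0 rn]; apply/lip_quotient_leP => // y xyr.
apply: le_trans (fn _ (le_lt_trans xyr rn)) _.
by rewrite ler_wpM2l.
Qed.

Lemma lip_ltyP f x : (lip f x < +oo)%E <->
  exists n : nat, forall m : nat, lip_small f n%:R m.+1%:R^-1 x.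
Proof.
split=> [/lty_exists_nat[n lipn]|[n fn]].
  exists n => m; have m0 : 0 < m.+1%:R^-1 :> R by rewrite invr_gt0.
  exact: (limf_einf_at_right0_leP _ _).1 (lexx (lip f x)) _ lipn _ m0.
apply: (@le_lt_trans _ _ n%:R%:E); last exact: ltry.
apply/limf_einf_at_right0_leP => d nd s /exists_natSinv_lt[m ms].
have [r /andP[r0 rm] frn] := fn m.
by exists r; [rewrite r0 (lt_trans rm)|exact: lt_trans frn nd].
Qed.

(** One index suffices for the bound and the scale because lip_small is
    monotone in both. *)
Lemma lip_eq0P f x : lip f x = 0%E <->
  forall n : nat, lip_small f n.+1%:R^-1 n.+1%:R^-1 x.
Proof.
split=> [lip0 n|fn].
  have n0 : 0 < n.+1%:R^-1 :> R by rewrite invr_gt0.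
  apply: (limf_einf_at_right0_leP _ _).1 (lexx (lip f x)) _ _ _ n0.
  by rewrite lip0 lte_fin.
apply/eqP; rewrite eq_le lip_ge0 andbT.
apply/limf_einf_at_right0_leP => d d0 s s0.
(* d may be +oo, so it is first replaced by a finite t. *)
have [t t0 td] : exists2 t, 0 < t & (t%:E <= d)%E.
  by case: d d0 => [t|_|//]; [exists t|exists 1; rewrite ?leey].
have [n] : exists n, n.+1%:R^-1 < Num.min s t.
  by apply: exists_natSinv_lt; rewrite lt_min s0.
rewrite lt_min => /andP[ns nt]; have [r /andP[r0 rn] frn] := fn n.
exists r; first by rewrite r0 (lt_trans rn).
by apply: lt_le_trans td; apply: lt_trans frn _; rewrite lte_fin.
Qed.

End local_lipschitz_sets.

Theorem lemma2p4 (R : realType) (f : R -> R) (hf : continuous f) :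
  [/\ Gdelta_sigma [set x : R | (lip f x < +oo)%E],
      Fsigma [set x : R | (Lip f x < +oo)%E] &
      Gdelta [set x : R | lip f x = 0%E]].
Proof.
split.
- exists (fun n => \bigcap_m lip_small f n%:R m.+1%:R^-1).
    move=> n; exists (fun m => lip_small f n%:R m.+1%:R^-1) => // m.
    exact: open_lip_small.
  apply/seteqP; split=> [x /lip_ltyP[n fn]|x [n _ fn]].
    by exists n => // m _; exact: fn.
  by apply/lip_ltyP; exists n => m; exact: fn.
- exists (fun n => [set x | forall y, `|x - y| < n.+1%:R^-1 ->
      `|f y - f x| <= n%:R * `|x - y|]).
    by move=> n; exact: closed_local_lipschitz.
  apply/seteqP; split=> [x /Lip_ltyP[n fn]|x [n _ fn]]; first by exists n.
  by apply/Lip_ltyP; exists n.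
- exists (fun n => lip_small f n.+1%:R^-1 n.+1%:R^-1).
    by move=> n; exact: open_lip_small.
  apply/seteqP; split=> [x /lip_eq0P fn n _|x fn]; first exact: fn.
  by apply/lip_eq0P => n; exact: fn.
Qed.
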